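(* There is a family of real polynomials $(P_n)_{n\geq 1}$, where $P_n$ is a polynomial in $n$ variables, such that the following hold: (1) $P_n$ can be computed by a $\Sigma\Pi\Sigma$ circuit of size $O(n^3)$; (2) any monotone arithmetic circuit computing $P_n$ has size at least $2^{\Omega(n)}$.
   Context: A $\Sigma\Pi\Sigma$ circuit (depth-three arithmetic circuit) over $\mathbb{R}$ computes a polynomial of the form $\sum_{i}\prod_{j}\ell_{i,j}$ where each $\ell_{i,j}$ is an affine linear form in the variables; its size is the number of wires/gates. A monotone arithmetic circuit over $\mathbb{R}$ is an arithmetic circuit with $+$ and $\times$ gates whose inputs are variables and nonnegative real constants; its size is its number of gates. The asymptotic notation hides absolute constants independent of $n$. *)

(* Defs.v *)
From HB Require Import structures.
From mathcomp Require Import all_boot all_order all_algebra.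
From mathcomp Require Import reals exp.
From mathcomp Require Import mpoly.

Set Implicit Arguments.
Unset Strict Implicit.
Unset Printing Implicit Defensive.

Import Order.TTheory GRing.Theory Num.Theory.

Local Open Scope ring_scope.

Record affine_form (R : Type) (n : nat) := AffineForm {
  af_coef : {ffun 'I_n -> R};
  af_const : R }.

Definition affine_poly (R : comNzRingType) (n : nat) (l : affine_form R n) :
    {mpoly R[n]} :=
  \sum_(i < n) af_coef l i *: 'X_i + (af_const l)%:MP.

(* The affine forms are indexed, so that a single bottom gate can feed several
   product gates, or the same product gate several times. *)
Record sps_circuit (R : Type) (n : nat) := SPSCircuit {
  sps_width : nat;
  sps_form : 'I_sps_width -> affine_form R n;
  sps_products : seq (seq 'I_sps_width) }.

Arguments sps_form {R n} S _ : rename.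

Definition sps_poly (R : comNzRingType) (n : nat) (S : sps_circuit R n) :
    {mpoly R[n]} :=
  \sum_(s <- sps_products S) \prod_(j <- s) affine_poly (sps_form S j).

Definition sps_gates (R : Type) (n : nat) (S : sps_circuit R n) : nat :=
  (sps_width S + size (sps_products S) + 1)%N.

(* Wires entering the bottom sum gate computing l: one for each variable, and
   one for the constant, occurring with a nonzero coefficient. *)
Definition affine_wires (R : comNzRingType) (n : nat) (l : affine_form R n) :
    nat :=
  (#|[set i | af_coef l i != 0%R]| + (af_const l != 0%R))%N.

Definition sps_wires (R : comNzRingType) (n : nat) (S : sps_circuit R n) :
    nat :=
  (\sum_(j < sps_width S) affine_wires (sps_form S j)
   + \sum_(s <- sps_products S) size s
   + size (sps_products S))%N.

(* Counting gates and wires together bounds either measure. *)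
Definition sps_size (R : comNzRingType) (n : nat) (S : sps_circuit R n) : nat :=
  (sps_gates S + sps_wires S)%N.

(* A wire of an arithmetic circuit starts at an input (a variable or a
   constant) or at the gate with the given position in the circuit. *)
Inductive source (R : Type) (n : nat) : Type :=
  | Var of 'I_n
  | Const of R
  | Gate of nat.

Inductive gate (R : Type) (n : nat) : Type :=
  | Add of source R n & source R n
  | Mul of source R n & source R n.

(* Straight-line form: the gates are listed in topological order.  Being
   acyclic, i.e. reading only earlier gates, is imposed by [circuit_wf]. *)
Record circuit (R : Type) (n : nat) := Circuit {
  gates : seq (gate R n);
  output : source R n }.

Definition circuit_size (R : Type) (n : nat) (C : circuit R n) : nat :=
  size (gates C).

Definition source_wf (R : Type) (n k : nat) (a : source R n) : bool :=
  if a is Gate j then (j < k)%N else true.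

Definition gate_wf (R : Type) (n k : nat) (g : gate R n) : bool :=
  match g with
  | Add a b | Mul a b => source_wf k a && source_wf k b
  end.

Fixpoint gates_wf (R : Type) (n k : nat) (gs : seq (gate R n)) : bool :=
  if gs is g :: gs' then gate_wf k g && gates_wf k.+1 gs' else true.

Definition circuit_wf (R : Type) (n : nat) (C : circuit R n) : bool :=
  gates_wf 0 (gates C) && source_wf (circuit_size C) (output C).

(* [vs] lists the polynomials computed by the preceding gates. *)
Definition source_poly (R : comNzRingType) (n : nat) (vs : seq {mpoly R[n]})
    (a : source R n) : {mpoly R[n]} :=
  match a with
  | Var i => 'X_i
  | Const c => c%:MP
  | Gate j => vs`_j
  end.

Definition gate_poly (R : comNzRingType) (n : nat) (vs : seq {mpoly R[n]})
    (g : gate R n) : {mpoly R[n]} :=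
  match g with
  | Add a b => source_poly vs a + source_poly vs b
  | Mul a b => source_poly vs a * source_poly vs b
  end.

Definition gates_polys (R : comNzRingType) (n : nat) (gs : seq (gate R n)) :
    seq {mpoly R[n]} :=
  foldl (fun vs g => rcons vs (gate_poly vs g)) [::] gs.

Definition circuit_poly (R : comNzRingType) (n : nat) (C : circuit R n) :
    {mpoly R[n]} :=
  source_poly (gates_polys (gates C)) (output C).

Definition source_monotone (R : numDomainType) (n : nat) (a : source R n) :
    bool :=
  if a is Const c then 0 <= c else true.

Definition gate_monotone (R : numDomainType) (n : nat) (g : gate R n) : bool :=
  match g with
  | Add a b | Mul a b => source_monotone a && source_monotone b
  end.

Definition circuit_monotone (R : numDomainType) (n : nat) (C : circuit R n) :
    bool :=
  all (@gate_monotone R n) (gates C) && source_monotone (output C).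

(* Exactly the polynomials computed by some monotone circuit. *)
Definition monotone_poly (R : numDomainType) (n : nat) (p : {mpoly R[n]}) :
    Prop :=
  forall m : 'X_{1..n}, 0 <= p@_m.

(* Main.v *)
(* Fix an alphabet X with a distinguished symbol [off] and a graph on the
   vertices 'I_m whose edges propose to each endpoint a private symbol (a port).
   For an assignment s of symbols to vertices let N(s) be the number of edges
   both of whose proposals are accepted by s, and take
     P = \sum_s (1 - N(s))^2 \prod_v X_(v, s v).
   Since 1 - N(s) is a signed sum of O(m) product functions of s, its square is
   a sum of O(m^2) of them, and each contributes one product of m linear forms.

   In a monotone circuit nothing cancels, so every monomial of P factors through
   a gate of degree between m/3 and 2m/3.  The monomials factoring through one
   gate form a combinatorial rectangle for a balanced cut of the vertices, and
   the rectangle avoids the assignments with N(s) = 1.  If the graph is an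
   expander, the cut is crossed by a linear matching, and the argument of Kaibel
   and Weltz for unique disjointness, applied along this matching, shows that
   the rectangle contains an exponentially small fraction of the assignments
   with N(s) = 0.  Hence exponentially many gates are needed.

   The expander is a random map from out-ports to in-ports, from which the
   colliding edges are deleted. *)

Require Import Defs.
From mathcomp Require Import all_boot all_order all_algebra.
From mathcomp Require Import reals exp.
From mathcomp Require Import mpoly.
From mathcomp Require boolp.
From mathcomp Require Import zify ring.

Set Implicit Arguments.
Unset Strict Implicit.
Unset Printing Implicit Defensive.

Import Order.TTheory GRing.Theory Num.Theory.

(** * Rectangles and unique disjointness *)

Section KaibelWeltz.

Variables (V X : finType) (off : X).

Definition assignment := {ffun V -> X}.

Definition edge := ((V * X) * (V * X))%type.

Definition upd (s : assignment) (e : edge) (x y : X) : assignment :=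
  [ffun v => if v == e.1.1 then x else if v == e.2.1 then y else s v].

Definition edge_disj (e e' : edge) : bool :=
  [&& e.1.1 != e'.1.1, e.1.1 != e'.2.1, e.2.1 != e'.1.1 & e.2.1 != e'.2.1].

Definition edge_ok (e : edge) : bool :=
  [&& e.1.1 != e.2.1, e.1.2 != off & e.2.2 != off].

(** For a valid edge, these are the states in which at most one endpoint accepts; they play the role
    of the bit pairs (0,0), (1,0), (0,1) of disjointness. *)
Definition alive_closed (M : seq edge) (Z : {set assignment}) : Prop :=
  forall e, e \in M -> forall s, s \in Z ->
  [/\ upd s e off off \in Z, upd s e e.1.2 off \in Z & upd s e off e.2.2 \in Z].

Lemma upd_id s e : upd s e (s e.1.1) (s e.2.1) = s.
Proof. by apply/ffunP => v; rewrite ffunE; do 2![case: eqP => [->//|_]]. Qed.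

Lemma upd_upd s e x y x' y' : upd (upd s e x' y') e x y = upd s e x y.
Proof. by apply/ffunP => v; rewrite !ffunE; do 2![case: eqP => //]. Qed.

Lemma upd1 s e x y : upd s e x y e.1.1 = x.
Proof. by rewrite ffunE eqxx. Qed.

Lemma upd2 s e x y : e.1.1 != e.2.1 -> upd s e x y e.2.1 = y.
Proof. by rewrite ffunE eq_sym eqxx => /negbTE ->. Qed.

Lemma updC s e e' x y x' y' : edge_disj e e' ->
  upd (upd s e x y) e' x' y' = upd (upd s e' x' y') e x y.
Proof.
case/and4P=> h1 h2 h3 h4; apply/ffunP => v; rewrite !ffunE.
have [->|_] := eqVneq v e.1.1; first by rewrite (negbTE h1) (negbTE h2).
by have [->|//] := eqVneq v e.2.1; rewrite (negbTE h3) (negbTE h4).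
Qed.

Lemma upd_disj1 s e e' x y : edge_disj e e' -> upd s e' x y e.1.1 = s e.1.1.
Proof. by case/and4P=> h1 h2 _ _; rewrite ffunE (negbTE h1) (negbTE h2). Qed.

Lemma upd_disj2 s e e' x y : edge_disj e e' -> upd s e' x y e.2.1 = s e.2.1.
Proof. by case/and4P=> _ _ h1 h2; rewrite ffunE (negbTE h1) (negbTE h2). Qed.

Section Step.

Variables (e : edge) (Z : {set assignment}).
Hypothesis eok : edge_ok e.
Hypothesis Zcl : alive_closed [:: e] Z.

Definition slice x y := [set s in Z | (s e.1.1 == x) && (s e.2.1 == y)].

Definition not_alive : {set assignment} :=
  [set s in Z | (s e.1.1, s e.2.1) \notin
     [:: (off, off); (e.1.2, off); (off, e.2.2)]].

(** Overwriting the endpoints of [e] is a bijection from [slice off off] to [slice x y], with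
    resetting to [off] as its inverse. *)
Lemma sum_slice x y (F : assignment -> nat) :
  (forall s, s \in Z -> upd s e x y \in Z) ->
  \sum_(s in slice x y) F s = \sum_(s in slice off off) F (upd s e x y).
Proof.
move=> cl; have [e0 _ _] := and3P eok.
rewrite (reindex_onto (fun s => upd s e x y) (fun s => upd s e off off)) /=.
  apply: eq_bigl => s; rewrite !inE upd_upd upd1 upd2 // !eqxx !andbT.
  apply/andP/and3P => [[sZ /eqP <-]|[sZ /eqP s1 /eqP s2]].
    rewrite upd1 upd2 // !eqxx; split=> //.
    by have [+ _ _] := Zcl (mem_head _ _) sZ; rewrite upd_upd.
  by split; [exact: cl | rewrite -{2}(upd_id s e) s1 s2].
by move=> s; rewrite inE => /and3P[_ /eqP <- /eqP <-]; rewrite upd_upd upd_id.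
Qed.

Lemma sum_alive (F : assignment -> nat) :
  \sum_(s in Z) F s = \sum_(s in not_alive) F s +
    \sum_(s in slice off off)
      (F s + F (upd s e e.1.2 off) + F (upd s e off e.2.2)).
Proof.
have [_ a0 b0] := and3P eok.
rewrite !big_split /= -!sum_slice; last 2 first.
- by move=> s /(Zcl (mem_head _ _))[].
- by move=> s /(Zcl (mem_head _ _))[].
rewrite ![\sum_(s in _) F s]big_mkcond -!big_split; apply: eq_bigr => s _ /=.
rewrite !inE !xpair_eqE; case: (s \in Z) => //=.
have [->|_] := eqVneq (s e.1.1) off; have [->|_] := eqVneq (s e.2.1) off.
- by rewrite (eq_sym off) (negbTE a0) (eq_sym off) (negbTE b0) /= !addn0.
- by rewrite !andbF /=; case: eqP => _ /=; rewrite ?addn0.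
- by rewrite andbT !orbF; case: eqP => _; rewrite ?addn0 ?add0n.
- by rewrite !andbF !addn0.
Qed.

Lemma card_alive : #|Z| = #|not_alive| + 3 * #|slice off off|.
Proof.
rewrite -!sum1_card sum_alive; congr (_ + _).
by rewrite sum1_card sum_nat_const mulnC.
Qed.

(** An element of [Z] is recovered from its reset copy in [slice off off] together with its two
    symbols at the endpoints of [e]. *)
Lemma card_slice : #|Z| <= #|X| ^ 2 * #|slice off off|.
Proof.
have [e0 _ _] := and3P eok.
have sub : Z \subset [set upd p.2 e p.1.1 p.1.2 |
                       p in setX [set: X * X] (slice off off)].
  apply/subsetP => s sZ; apply/imsetP.
  exists ((s e.1.1, s e.2.1), upd s e off off); last by rewrite upd_upd upd_id.
  rewrite !inE /= upd1 upd2 // !eqxx !andbT.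
  by have [] := Zcl (mem_head _ _) sZ.
apply: leq_trans (subset_leq_card sub) _; apply: leq_trans (leq_imset_card _ _) _.
by rewrite cardsX cardsT card_prod.
Qed.

Lemma slice_alive_closed M x y : all (edge_disj e) M ->
  alive_closed M Z -> alive_closed M (slice x y).
Proof.
move=> /allP dis cl e' e'M s; rewrite !inE => /and3P[sZ sx sy].
have [h1 h2 h3] := cl _ e'M _ sZ.
by rewrite !upd_disj1 ?upd_disj2 ?dis // h1 h2 h3 sx sy.
Qed.

Lemma not_alive_closed M : all (edge_disj e) M ->
  alive_closed M Z -> alive_closed M not_alive.
Proof.
move=> /allP dis cl e' e'M s; rewrite !inE !negb_or => /andP[sZ sxy].
have [h1 h2 h3] := cl _ e'M _ sZ.
by rewrite !upd_disj1 ?upd_disj2 ?dis // h1 h2 h3 sxy.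
Qed.

End Step.

Definition local_left (M : seq edge) (A : pred assignment) : Prop :=
  forall e, e \in M -> forall s x y, A (upd s e x y) = A (upd s e x off).

Definition local_right (M : seq edge) (B : pred assignment) : Prop :=
  forall e, e \in M -> forall s x y, B (upd s e x y) = B (upd s e off y).

(** When [A] ignores right endpoints and [B] ignores left ones, this says that the rectangle misses
    [upd s e e.1.2 e.2.2], where [e] is accepted at both ends. *)
Definition never_both (M : seq edge) (Z : {set assignment})
    (A B : pred assignment) : Prop :=
  forall e, e \in M -> forall s, s \in Z ->
  ~~ (A (upd s e e.1.2 off) && B (upd s e off e.2.2)).

(** Induction on the matching. For each edge, the three equal slices of alive states are charged to
    two rectangles on one slice, so one slice is saved; it is at least a 1/|X|^2 share of [Z]. The
    predicates must stay general, since they change along the induction. *)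
Theorem kaibel_weltz (M : seq edge) (Z : {set assignment})
    (A B : pred assignment) :
  all edge_ok M -> pairwise edge_disj M -> alive_closed M Z ->
  local_left M A -> local_right M B -> never_both M Z A B ->
  (\sum_(s in Z) (A s && B s)) * (#|X| ^ 2) ^ size M
    <= (#|X| ^ 2).-1 ^ size M * #|Z|.
Proof.
elim: M Z A B => [|e M IH] Z A B /=.
  move=> _ _ _ _ _ _; rewrite muln1 mul1n -sum1_card.
  by apply: leq_sum => s _; case: andb.
move=> /andP[eok Mok] /andP[edis Mdis] cl lA lB av.
have cle : alive_closed [:: e] Z.
  by move=> e'; rewrite inE => /eqP-> s /(cl _ (mem_head _ _)).
have clM : alive_closed M Z.
  by move=> e' e'M; apply: cl; rewrite inE e'M orbT.
have lAM : local_left M A by move=> e' e'M; apply: lA; rewrite inE e'M orbT.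
have lBM : local_right M B by move=> e' e'M; apply: lB; rewrite inE e'M orbT.
have avM : never_both M Z A B.
  by move=> e' e'M; apply: av; rewrite inE e'M orbT.
pose Z0 := slice e Z off off.
have Z0Z s : s \in Z0 -> s \in Z by rewrite inE => /andP[].
have Z0e s : s \in Z0 -> upd s e off off = s.
  by rewrite inE => /and3P[_ /eqP s1 /eqP s2]; rewrite -{2}(upd_id s e) s1 s2.
have clZ0 : alive_closed M Z0 by exact: slice_alive_closed.
pose A1 := [pred s | A (upd s e e.1.2 off)].
pose B1 := [pred s | B (upd s e off e.2.2)].
have dis e' : e' \in M -> edge_disj e e' by move/(allP edis).
have dis' e' : e' \in M -> edge_disj e' e.
  by move/dis/and4P=> [h1 h2 h3 h4]; apply/and4P; split; rewrite eq_sym.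
have lA1 : local_left M [pred s | A s || A1 s].
  by move=> e' e'M s x y /=; rewrite lAM // !(updC _ _ _ _ _ (dis' _ e'M)) lAM.
have lB1 : local_right M [pred s | B s || B1 s].
  by move=> e' e'M s x y /=; rewrite lBM // !(updC _ _ _ _ _ (dis' _ e'M)) lBM.
have nr : never_both M (not_alive e Z) A B.
  by move=> e' e'M s; rewrite inE => /andP[sZ _]; apply: avM.
(* [B1] looks at [s] with [e] set to [(off, e.2.2)]. This assignment is again in [Z], and [A] cannot
   see the change, so the hypothesis applies to it. *)
have nA : never_both M Z0 A [pred s | B s || B1 s].
  move=> e' e'M s sZ0 /=; rewrite andb_orr negb_or avM ?Z0Z //=.
  have [_ _ sb] := cle _ (mem_head _ _) _ (Z0Z _ sZ0).
  have := avM _ e'M _ sb; rewrite !(updC _ _ _ _ _ (dis _ e'M)).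
  by rewrite lA ?mem_head // -(updC _ _ _ _ _ (dis _ e'M)) Z0e.
have nB : never_both M Z0 [pred s | A s || A1 s] B.
  move=> e' e'M s sZ0 /=; rewrite andb_orl negb_or avM ?Z0Z //=.
  have [_ sa _] := cle _ (mem_head _ _) _ (Z0Z _ sZ0).
  have := avM _ e'M _ sa; rewrite !(updC _ _ _ _ _ (dis _ e'M)).
  by rewrite lB ?mem_head // -[upd (upd s e' off _) _ _ _](updC _ _ _ _ _ (dis _ e'M)) Z0e.
have I1 := IH _ _ _ Mok Mdis (not_alive_closed edis clM) lAM lBM nr.
have I2 := IH _ _ _ Mok Mdis clZ0 lAM lB1 nA.
have I3 := IH _ _ _ Mok Mdis clZ0 lA1 lBM nB.
(* As [A1 s && B1 s] fails, the three alive states of [e] contribute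
   A B + A1 B + A B1 <= A (B || B1) + (A || A1) B, two rectangles instead of
   three. *)
have split_le : \sum_(s in Z) (A s && B s) <=
    \sum_(s in not_alive e Z) (A s && B s) +
    (\sum_(s in Z0) (A s && [pred s | B s || B1 s] s) +
     \sum_(s in Z0) ([pred s | A s || A1 s] s && B s)).
  rewrite (sum_alive eok cle) leq_add2l -big_split.
  apply: leq_sum => s sZ0 /=.
  have := av _ (mem_head _ _) _ (Z0Z _ sZ0).
  rewrite [A (upd s e off _)]lA ?mem_head // [B (upd s e _ off)]lB ?mem_head //.
  rewrite !Z0e // /A1 /B1 /=.
  by do 2![case: (A _); case: (B _)].
have cZ := card_alive eok cle.
have cS := card_slice eok cle.
rewrite -/Z0 in cZ cS *.
set k := size M in I1 I2 I3 *; set L := #|X| ^ 2 in I1 I2 I3 cS *.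
set S1 := \sum_(s in not_alive e Z) _ in I1 split_le.
set S2 := \sum_(s in Z0) _ in I2 split_le.
set S3 := \sum_(s in Z0) _ in I3 split_le.
set S := \sum_(s in Z) _ in split_le *.
rewrite !expnS; set P := L.-1 ^ k in I1 I2 I3 *; set Q := L ^ k in I1 I2 I3 *.
(* The three domains have total size |not_alive| + 2 |Z0| = |Z| - |Z0|. *)
have h1 : S * Q <= P * (#|Z| - #|Z0|).
  have -> : #|Z| - #|Z0| = #|not_alive e Z| + (#|Z0| + #|Z0|) by lia.
  apply: leq_trans (leq_mul split_le (leqnn _)) _.
  by rewrite !mulnDl !mulnDr; apply: leq_add => //; apply: leq_add.
have h2 : (#|Z| - #|Z0|) * L <= L.-1 * #|Z|.
  by rewrite mulnBl -subn1 mulnBl mul1n [#|Z| * L]mulnC leq_sub2l // mulnC.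
rewrite mulnCA [L.-1 * P]mulnC -mulnA mulnC.
apply: leq_trans (leq_mul h1 (leqnn _)) _.
by rewrite -mulnA leq_mul2l h2 orbT.
Qed.

End KaibelWeltz.

(** * Matchings across a cut, and covers by balanced rectangles *)

Section Covers.

Variables (V X : finType) (off : X).

Implicit Types (s : assignment V X) (e : edge V X) (G : {set edge V X}).

(** All edges cross the cut in the same direction, so an edge meets a chosen [e] only in the same
    tail or the same head. By injectivity each vertex is the tail of at most |X| edges and the head
    of at most |X|, so one choice discards at most 2 |X| edges. *)
Lemma greedy_matching (I : {set V}) (C : {set edge V X}) :
  {in C &, injective fst} -> {in C &, injective snd} ->
  (forall e, e \in C -> (e.1.1 \in I) && (e.2.1 \notin I)) ->
  exists M : seq (edge V X),
    [/\ {subset M <= C}, pairwise (@edge_disj V X) M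
      & #|C| <= (2 * #|X|) * size M].
Proof.
have [n] := ubnP #|C|; elim: n C => // n IH C; rewrite ltnS => leCn i1 i2 cr.
have [->|[e eC]] := set_0Vmem C; first by exists [::]; rewrite cards0.
pose C' := [set e' in C | edge_disj e e'].
have sC' e' : e' \in C' -> e' \in C by rewrite inE => /andP[].
have ltC' : #|C'| < n.
  apply: leq_trans leCn; apply: proper_card; apply/properP; split.
    exact/subsetP.
  by exists e; rewrite // inE eC /edge_disj eqxx.
have [M [sM dM cM]] := IH _ ltC' (sub_in2 sC' i1) (sub_in2 sC' i2)
  (fun e' h => cr e' (sC' e' h)).
exists (e :: M); split.
- by move=> e'; rewrite inE => /predU1P[->//|/sM/sC'].
- rewrite /= dM andbT; apply/allP => e' /sM; by rewrite inE => /andP[].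
have port (f : edge V X -> V * X) (v : V) : {in C &, injective f} ->
    #|[set e' in C | (f e').1 == v]| <= #|X|.
  move=> fi; rewrite -(card_in_imset (f := fun e' => (f e').2)) ?max_card //.
  move=> e1 e2; rewrite !inE => /andP[h1 /eqP v1] /andP[h2 /eqP v2] eq2.
  by apply: fi => //; rewrite [LHS]surjective_pairing v1 eq2 -v2 -surjective_pairing.
have sub : C :\: C' \subset
   [set e' in C | e'.1.1 == e.1.1] :|: [set e' in C | e'.2.1 == e.2.1].
  apply/subsetP => e'; rewrite !inE => /andP[+ e'C]; rewrite e'C /=.
  have /andP[uI wI] := cr _ eC; have /andP[uI' wI'] := cr _ e'C.
  have n1 : e.1.1 != e'.2.1 by apply: contraNneq wI' => <-.
  have n2 : e.2.1 != e'.1.1 by apply: contraNneq wI => ->.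
  by rewrite /edge_disj n1 n2 /= negb_and !negbK !(eq_sym e.1.1) !(eq_sym e.2.1).
rewrite -(cardsID C' C) /= mulnS addnC; apply: leq_add.
  apply: leq_trans (subset_leq_card sub) _.
  apply: leq_trans (leq_card_setU _ _) _; rewrite mul2n -addnn.
  by apply: leq_add; [exact: (port fst) | exact: (port snd)].
by apply: leq_trans cM; apply: subset_leq_card; apply: subsetIr.
Qed.

Definition mutual s e := (s e.1.1 == e.1.2) && (s e.2.1 == e.2.2).

Definition mutual_count G s := #|[set e in G | mutual s e]|.

Definition port_matching G : Prop :=
  [/\ forall e, e \in G -> (e.1.2 != off) && (e.2.2 != off),
      {in G &, injective fst}, {in G &, injective snd}
    & forall e e', e \in G -> e' \in G -> e.1 <> e'.2].

Definition mutual_free G : {set assignment V X} :=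
  [set s | mutual_count G s == 0].

Definition splice (I : {set V}) s1 s2 : assignment V X :=
  [ffun v => if v \in I then s1 v else s2 v].

Section PortMatching.

Variables (G : {set edge V X}).
Hypothesis Gport : port_matching G.

Lemma mutual_freeP s :
  reflect (forall e, e \in G -> ~~ mutual s e) (s \in mutual_free G).
Proof.
rewrite inE cards_eq0; apply: (iffP eqP) => [s0 e eG|h].
  by apply: contraFN (in_set0 e) => me; rewrite -s0 inE eG.
by apply/setP => e; rewrite !inE; apply/negP => /andP[/h /negP].
Qed.

Lemma off_mutual_free : [ffun=> off] \in mutual_free G.
Proof.
have [h _ _ _] := Gport; apply/mutual_freeP => e /h /andP[h1 _].
by rewrite /mutual ffunE eq_sym (negbTE h1).
Qed.

(* Each port belongs to at most one edge, so the symbols that an edge proposes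
   to its endpoints cannot create a mutual choice along another edge. *)
Lemma mutual_upd s e e' x y : s \in mutual_free G -> e \in G -> e' \in G ->
  e.1.1 != e.2.1 -> x \in [:: off; e.1.2] -> y \in [:: off; e.2.2] ->
  mutual (upd s e x y) e' -> [/\ e' = e, x = e.1.2 & y = e.2.2].
Proof.
move=> /mutual_freeP sZ eG e'G ne xP yP; have [offG i1 i2 i12] := Gport.
have /andP[o1 o2] := offG _ e'G.
have [->|ee'] := eqVneq e' e.
  by case/andP; rewrite upd1 upd2 // => /eqP-> /eqP->.
case/andP=> /eqP m1 /eqP m2; case/negP: (sZ _ e'G); apply/andP; split; apply/eqP.
- move: m1; rewrite ffunE; case: eqP => [eu|_].
    move=> ex; move: xP; rewrite ex !inE (negbTE o1) /= => /eqP ea.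
    case/eqP: ee'; apply: i1 => //.
    by rewrite [LHS]surjective_pairing eu ea -surjective_pairing.
  case: eqP => // ew ey; move: yP; rewrite ey !inE (negbTE o1) /= => /eqP eb.
  case: (i12 _ _ e'G eG).
  by rewrite [LHS]surjective_pairing ew eb -surjective_pairing.
- move: m2; rewrite ffunE; case: eqP => [eu|_].
    move=> ex; move: xP; rewrite ex !inE (negbTE o2) /= => /eqP ea.
    case: (i12 _ _ eG e'G).
    by rewrite [RHS]surjective_pairing eu ea -surjective_pairing.
  case: eqP => // ew ey; move: yP; rewrite ey !inE (negbTE o2) /= => /eqP eb.
  case/eqP: ee'; apply: i2 => //.
  by rewrite [LHS]surjective_pairing ew eb -surjective_pairing.
Qed.

Lemma upd_mutual_free s e x y : s \in mutual_free G -> e \in G ->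
  e.1.1 != e.2.1 -> x \in [:: off; e.1.2] -> y \in [:: off; e.2.2] ->
  (x == off) || (y == off) -> upd s e x y \in mutual_free G.
Proof.
move=> sZ eG ne xP yP xy; apply/mutual_freeP => e' e'G; apply/negP => m.
have [_ ex ey] := mutual_upd sZ eG e'G ne xP yP m.
have [offG _ _ _] := Gport; have /andP[o1 o2] := offG _ eG.
by case/orP: xy; rewrite ?ex ?ey ?(negbTE o1) ?(negbTE o2).
Qed.

Lemma mutual_count_upd s e : s \in mutual_free G -> e \in G ->
  e.1.1 != e.2.1 -> mutual_count G (upd s e e.1.2 e.2.2) = 1.
Proof.
move=> sZ eG ne; apply/eqP/cards1P; exists e; apply/setP => e'; rewrite !inE.
apply/andP/eqP => [[e'G m]|->].
  by have [] := mutual_upd sZ eG e'G ne _ _ m; rewrite ?inE ?eqxx ?orbT.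
by split=> //; rewrite /mutual upd1 upd2 // !eqxx.
Qed.

Lemma rectangle_bound (I : {set V}) (R : {set assignment V X})
    (M : seq (edge V X)) :
  {subset M <= G} -> pairwise (@edge_disj V X) M ->
  (forall e, e \in M -> (e.1.1 \in I) && (e.2.1 \notin I)) ->
  (forall s1 s2, s1 \in R -> s2 \in R ->
     mutual_count G (splice I s1 s2) != 1) ->
  #|R :&: mutual_free G| * (#|X| ^ 2) ^ size M
    <= (#|X| ^ 2).-1 ^ size M * #|mutual_free G|.
Proof.
move=> sM dM cM hR.
(* [A] and [B] are the two sides of the rectangle generated by [R]; an assignment passing both is a
   splice of two members of [R]. *)
pose A (s : assignment V X) := [exists s1 in R, [forall v in I, s1 v == s v]].
pose B (s : assignment V X) := [exists s2 in R, [forall v in ~: I, s2 v == s v]].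
have AB s : A s -> B s -> mutual_count G s != 1.
  move=> /exists_inP[s1 r1 /forall_inP e1] /exists_inP[s2 r2 /forall_inP e2].
  suff -> : s = splice I s1 s2 by apply: hR.
  apply/ffunP => v; rewrite ffunE; case: ifPn => vI; apply/esym/eqP.
    exact: e1.
  by apply: e2; rewrite inE.
have ne e : e \in M -> e.1.1 != e.2.1.
  by move/cM/andP=> [h1 h2]; apply: contraNneq h2 => <-.
have lA : local_left off M A.
  move=> e eM s x y /=; apply: eq_existsb => s1; congr (_ && _).
  apply: eq_forallb => v; rewrite !ffunE; have [vI|//] := boolP (v \in I).
  have /andP[_ wI] := cM _ eM; rewrite (negbTE (_ : v != e.2.1)) //.
  by apply: contraNneq wI => <-.
have lB : local_right off M B.
  move=> e eM s x y /=; apply: eq_existsb => s1; congr (_ && _).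
  apply: eq_forallb => v; rewrite !ffunE inE; have [//|vI] := boolP (v \in I).
  have /andP[uI _] := cM _ eM; rewrite (negbTE (_ : v != e.1.1)) //.
  by apply: contraNneq vI => ->.
have cl : alive_closed off M (mutual_free G).
  move=> e eM s sZ.
  split; apply: (upd_mutual_free sZ (sM _ eM) (ne _ eM)); by rewrite ?inE ?eqxx ?orbT.
have nb : never_both off M (mutual_free G) A B.
  move=> e eM s sZ; apply/negP => /andP[hA hB].
  have := AB (upd s e e.1.2 e.2.2).
  rewrite (lA _ eM) (lB _ eM) (mutual_count_upd sZ (sM _ eM) (ne _ eM)).
  by move=> /(_ hA hB).
have okM : all (edge_ok off) M.
  apply/allP => e eM; rewrite /edge_ok ne //=.
  by have [offG _ _ _] := Gport; apply: offG; apply: sM.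
apply: leq_trans (kaibel_weltz okM dM cl lA lB nb); rewrite leq_mul2r.
apply/orP; right; rewrite -sum1_card.
rewrite [X in _ <= X]big_mkcond [X in X <= _]big_mkcond; apply: leq_sum => s _.
rewrite inE andbC; case: (s \in mutual_free G) => //=.
case: ifP => // sR; rewrite (_ : [exists _ in R, _] && _ = true) //.
by apply/andP; split; apply/exists_inP; exists s => //; apply/forall_inP.
Qed.

End PortMatching.

(** Expansion is asked of balanced cuts, the kind of cut that the selected gates of a circuit
    induce. *)
Definition expander (G : {set edge V X}) : Prop :=
  port_matching G /\
  forall I : {set V}, #|V| <= 3 * #|I| -> #|V| <= 3 * #|~: I| ->
    #|V| <= 2 * #|[set e in G | (e.1.1 \in I) && (e.2.1 \notin I)]|.

Definition balanced_rectangle G (R : {set assignment V X}) : Prop :=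
  exists I : {set V}, [/\ #|V| <= 3 * #|I|, #|V| <= 3 * #|~: I|
    & forall s1 s2, s1 \in R -> s2 \in R ->
        mutual_count G (splice I s1 s2) != 1].

(** With [C] the crossing edges, |V| <= 2 |C| <= 4 |X| |M| for the greedy matching [M], which
    therefore has at least [k] edges. *)
Lemma balanced_rectangle_bound G R k : k * (4 * #|X|) <= #|V| ->
  expander G -> balanced_rectangle G R ->
  #|R :&: mutual_free G| * (#|X| ^ 2) ^ k
    <= (#|X| ^ 2).-1 ^ k * #|mutual_free G|.
Proof.
move=> kV [Gport Gexp] [I [I1 I2 hR]].
have X0 : 0 < #|X| by apply/card_gt0P; exists off.
set C := [set e in G | (e.1.1 \in I) && (e.2.1 \notin I)].
have CG e : e \in C -> e \in G by rewrite inE => /andP[].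
have [_ i1 i2 _] := Gport.
have [|M [sM dM cM]] := greedy_matching (sub_in2 CG i1) (sub_in2 CG i2) (I := I).
  by move=> e; rewrite inE => /andP[].
have kM : k <= size M.
  rewrite -(@leq_pmul2r (4 * #|X|)) ?muln_gt0 //; apply: leq_trans kV _.
  apply: leq_trans (Gexp _ I1 I2) _; apply: leq_trans (leq_mul (leqnn 2) cM) _.
  by rewrite leq_eqVlt; apply/orP; left; apply/eqP; ring.
(* Truncating to exactly [k] edges gives the same bound for all rectangles. *)
have -> : k = size (take k M) by rewrite size_takel.
have sT e : e \in take k M -> e \in C by move/mem_take/sM.
apply: (rectangle_bound Gport _ _ _ hR).

- by move=> e /sT/CG.
- by move: dM; rewrite -{1}(cat_take_drop k M) pairwise_cat => /and3P[].
- by move=> e /sT; rewrite inE => /andP[].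
Qed.

(** Each rectangle holds at most a (1 - 1/|X|^2)^k share of the mutual-free assignments, a set that
    is nonempty because it contains the all-[off] one. *)
Lemma cover_bound (J : finType) (R : J -> {set assignment V X}) G k :
  k * (4 * #|X|) <= #|V| -> expander G ->
  (forall j, R j = set0 \/ balanced_rectangle G (R j)) ->
  (forall s, s \in mutual_free G -> exists j, s \in R j) ->
  (#|X| ^ 2) ^ k <= #|J| * (#|X| ^ 2).-1 ^ k.
Proof.
move=> kV Gexp hR cov.
have Z0 : 0 < #|mutual_free G|.
  by apply/card_gt0P; exists [ffun=> off]; apply: off_mutual_free Gexp.1.
rewrite -(leq_pmul2r Z0).
have sub : #|mutual_free G| <= \sum_j #|R j :&: mutual_free G|.
  rewrite -sum1_card.
  apply: leq_trans (_ : _ <= \sum_(s in mutual_free G) \sum_j (s \in R j)) _.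
    by apply: leq_sum => s /cov[j sj]; rewrite (bigD1 j) //= sj.
  rewrite exchange_big /=; apply: leq_sum => j _; rewrite -sum1_card.
  rewrite [X in X <= _]big_mkcond [X in _ <= X]big_mkcond; apply: leq_sum => s _.
  by rewrite in_setI andbC; case: ifP => //; case: (_ \in R j).
apply: leq_trans (_ : _ <= (\sum_j #|R j :&: mutual_free G|) * (#|X| ^ 2) ^ k) _.
  by rewrite mulnC leq_mul2r sub orbT.
rewrite big_distrl /= -mulnA -sum_nat_const; apply: leq_sum => j _.
case: (hR j) => [->|]; first by rewrite set0I cards0 mul0n.
exact: balanced_rectangle_bound.
Qed.

(** With L = l + 1, the first two terms of the binomial expansion of (l + 1)^L are l^L and L l^l,
    and each is at least l^L. *)
Lemma bernoulli_expn (L : nat) : 0 < L -> 2 * L.-1 ^ L <= L ^ L.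
Proof.
case: L => // l _ /=.
have h n : l ^ n.+1 + n.+1 * l ^ n <= l.+1 ^ n.+1.
  elim: n => [|n IH]; first by rewrite !expn1 expn0; lia.
  rewrite [l.+1 ^ _]expnS; apply: leq_trans (leq_mul (leqnn _) IH).
  rewrite ![l ^ _.+1]expnS; nia.
apply: leq_trans (h l); rewrite mul2n -addnn leq_add2l [X in X <= _]expnS.
by rewrite leq_mul2r leqnSn orbT.
Qed.

(** Raising to the power [L] turns the ratio (L / (L - 1))^k into at least 2^k. *)
Lemma expn_ratio_bound (L k s : nat) :
  1 < L -> L ^ k <= s * L.-1 ^ k -> 2 ^ k <= s ^ L.
Proof.
move=> L1 h; have L0 : 0 < L.-1 ^ (k * L) by rewrite expn_gt0 -subn1 subn_gt0 L1.
rewrite -(leq_pmul2r L0); apply: leq_trans (_ : (L ^ k) ^ L <= _); last first.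
  by rewrite expnM -expnMn leq_exp2r // ltnW.
rewrite -expnM [k * L]mulnC [L ^ _]expnM [L.-1 ^ _]expnM -expnMn.
have [->//|k0] := posnP k.
by rewrite leq_exp2r //; apply: bernoulli_expn; apply: ltnW.
Qed.

End Covers.

(** * Existence of expanders *)

Section ExpanderExistence.

Variables (m c D : nat).
Hypotheses (m_gt1 : 1 < m) (c_large : 16 * 3 ^ c <= 4 ^ c).
Let d := 3 * c.
Hypothesis D_def : D = 4 * d ^ 2.

(** [S] collects the out-ports, [d] per vertex, and [T] the in-ports, [D] per vertex. Probabilities
    over uniform maps from [S] to [T] are expressed by counting. *)
Let S := ('I_m * 'I_d)%type.
Let T := ('I_m * 'I_D)%type.

Implicit Types (f : {ffun S -> T}) (I : {set 'I_m}).

Definition crossing I f : {set S} :=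
  [set x : S | (x.1 \in I) && ((f x).1 \notin I)].

Definition colliding f : {set S} :=
  [set x | [exists y, (y != x) && (f y == f x)]].

Let c_gt0 : 0 < c.
Proof. by move: c_large; case: c. Qed.

Let D_gt0 : 0 < D.
Proof. by rewrite D_def muln_gt0 /= expn_gt0 /d; lia. Qed.

Let cardS : #|{: S}| = m * d.
Proof. by rewrite card_prod !card_ord. Qed.

Let cardT : #|{: T}| = m * D.
Proof. by rewrite card_prod !card_ord. Qed.

Let cardI (k : nat) I : #|[set x : 'I_m * 'I_k | x.1 \in I]| = #|I| * k.
Proof.
have -> : [set x : 'I_m * 'I_k | x.1 \in I] = setX I setT.
  by apply/setP => x; rewrite !inE andbT.
by rewrite cardsX cardsT card_ord.
Qed.

(* Chernoff's bound for the moment [4 ^ (m * d - #|crossing I f|)]. *)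
Lemma few_crossing_rare I : m <= 3 * #|I| -> m <= 3 * #|~: I| ->
  #|[set f | #|crossing I f| < m]| * 4 ^ m <= #|{: {ffun S -> T}}|.
Proof.
move=> I1 I2; set bad := [set f | _].
have Im : #|I| + #|~: I| = m by rewrite cardsC card_ord.
pose w (x : S) (t : T) := if (x.1 \in I) && (t.1 \notin I) then 1 else 4.
have w_bad f : f \in bad -> 4 ^ (m * d - m) <= \prod_x w x (f x).
  rewrite inE => fb.
  have -> : \prod_x w x (f x) = 4 ^ #|~: crossing I f|.
    rewrite -prod_nat_const [RHS]big_mkcond /=; apply: eq_bigr => x _.
    by rewrite !inE /w; case: andb.
  by rewrite leq_exp2l // -cardS -(cardsC (crossing I f)) leq_subLR leq_add2r ltnW.
(* For [x.1] in [I] the mean of [w x] is 4 - 3 |~: I| / m, at most 3 since the complement has at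
   least a third of the vertices. *)
have sum_w x : \sum_t w x t <= (if x.1 \in I then 3 else 4) * (m * D).
  case: ifPn => xI; last first.
    rewrite -cardT mulnC -sum_nat_const; apply: leq_sum => t _.
    by rewrite /w; case: ifP.
  have -> : \sum_t w x t = #|[set t : T | t.1 \in ~: I]| + 4 * #|[set t : T | t.1 \in I]|.
    rewrite mulnC -!sum_nat_const -sum1_card [X in _ = X + _]big_mkcond.
    rewrite [X in _ = _ + X]big_mkcond -big_split; apply: eq_bigr => t _ /=.
    by rewrite /w xI !inE; case: (t.1 \in I).
  rewrite !cardI; nia.
have sum_prod : #|bad| * 4 ^ (m * d - m) <=
    3 ^ (#|I| * d) * 4 ^ (#|~: I| * d) * (m * D) ^ (m * d).
  apply: (@leq_trans (\sum_(f : {ffun S -> T}) \prod_x w x (f x))).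
    rewrite -sum_nat_const big_mkcond; apply: leq_sum => f _.
    by case: ifP => // /w_bad.
  rewrite -bigA_distr_bigA; apply: leq_trans (leq_prod (fun x _ => sum_w x)) _.
  rewrite big_split /= prod_nat_const cardS leq_mul2r; apply/orP; right.
  rewrite -!cardI -!prod_nat_const [X in _ <= X * _]big_mkcond.
  rewrite [X in _ <= _ * X]big_mkcond -big_split /=; apply: leq_prod => x _.
  by rewrite !inE; case: (x.1 \in I).
(* The moment gains (3/4)^(|I| d) <= (3/4)^(m c) <= 16^(-m). One factor 4^m pays for the threshold
   [m * d - m], the other is the claimed rarity. *)
have cI : m * c <= #|I| * d by rewrite /d; nia.
have l34 e : 3 ^ e <= 4 ^ e by case: e => // e; rewrite leq_exp2r.
have key : 3 ^ (#|I| * d) * 4 ^ (#|~: I| * d) * 16 ^ m <= 4 ^ (m * d).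
  have -> : m * d = #|I| * d + #|~: I| * d by rewrite -mulnDl Im.
  rewrite expnD -{1}(subnKC cI) expnD.
  apply: leq_trans (_ : _ <= (16 * 3 ^ c) ^ m *
     4 ^ (#|I| * d - m * c) * 4 ^ (#|~: I| * d)) _.
    rewrite expnMn -expnM [c * m]mulnC.
    rewrite [X in X <= _](_ : _ = 16 ^ m * 3 ^ (m * c) * 3 ^ (#|I| * d - m * c)
      * 4 ^ (#|~: I| * d)); last by ring.
    by rewrite leq_mul2r leq_mul2l l34 ?orbT.
  rewrite leq_mul2r -{2}(subnKC cI) expnD leq_mul2r [m * c]mulnC
    [4 ^ (c * m)]expnM.
  by rewrite leq_exp2r ?c_large ?orbT // ltnW.
rewrite card_ffun cardT cardS -(@leq_pmul2r (4 ^ (m * d))) ?expn_gt0 //.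
have -> : #|bad| * 4 ^ m * 4 ^ (m * d) = #|bad| * 4 ^ (m * d - m) * 16 ^ m.
  rewrite (_ : 16 = 4 * 4) // expnMn.
  have {1}-> : m * d = m * d - m + m by rewrite subnK // /d; nia.
  by rewrite expnD; ring.
apply: leq_trans (leq_mul sum_prod (leqnn _)) _.
by rewrite mulnAC mulnC leq_mul2l key orbT.
Qed.

(** Replacing the value at [x] by an arbitrary [t] is injective on pairs of such an [f] and [t],
    because the old value survives at [y]. *)
Lemma collision_rare (x y : S) : x != y ->
  #|[set f : {ffun S -> T} | f x == f y]| * (m * D) <= #|{: {ffun S -> T}}|.
Proof.
move=> xy; rewrite -cardT -cardsT -cardsX.
pose h (p : {ffun S -> T} * T) := [ffun z => if z == x then p.2 else p.1 z].
have hx p : h p x = p.2 by rewrite ffunE eqxx.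
have hz p z : z != x -> h p z = p.1 z by rewrite ffunE => /negbTE->.
rewrite -(card_in_imset (f := h)) ?max_card //.
move=> [f t] [f' t']; rewrite !inE /= !andbT => /eqP fxy /eqP fxy' hh.
have ht : t = t' by rewrite -[t](hx (f, t)) hh hx.
have hf z : z != x -> f z = f' z by move=> zx; rewrite -[f z](hz (f, t)) // hh hz.
congr pair => //; apply/ffunP => z.
by have [->|/hf//] := eqVneq z x; rewrite fxy fxy' hf // eq_sym.
Qed.

(** Summing over ordered pairs, the mean number of colliding ports is at most (m d)^2 / (m D) = m /
    4 by the choice of [D]; Markov's inequality gives probability at most 1/2. *)
Lemma many_collisions_rare :
  #|[set f | m <= 2 * #|colliding f|]| * 2 <= #|{: {ffun S -> T}}|.
Proof.
set bad := [set f | _]; set F := #|_ : predArgType|.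
have h1 : #|bad| * m <= 2 * \sum_f #|colliding f|.
  rewrite -sum_nat_const big_mkcond big_distrr; apply: leq_sum => f _ /=.
  by case: ifP => //; rewrite inE.
have h2 : (\sum_f #|colliding f|) * (m * D) <= (m * d) * (m * d) * F.
  apply: leq_trans (_ : _ <= (\sum_(x : S) \sum_(y : S | y != x)
      #|[set f : {ffun S -> T} | f y == f x]|) * (m * D)) _.
    rewrite leq_mul2r; apply/orP; right.
    apply: (@leq_trans (\sum_(f : {ffun S -> T}) \sum_x
      \sum_(y | y != x) (f y == f x))).
      apply: leq_sum => f _; rewrite -sum1_card big_mkcond; apply: leq_sum => x _.
      rewrite inE; case: ifP => // /existsP[y /andP[yx fyx]].
      by rewrite (bigD1 y) //= fyx.
    rewrite exchange_big; apply: leq_sum => x _ /=.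
    rewrite exchange_big; apply: leq_sum => y _ /=.
    rewrite -sum1_card [X in _ <= X]big_mkcond; apply: leq_sum => f _.
    by rewrite inE; case: eqP.
  rewrite -cardS big_distrl /= -mulnA -sum_nat_const; apply: leq_sum => x _.
  rewrite big_distrl -sum_nat_const big_mkcond; apply: leq_sum => y _ /=.
  by case: ifP => // /collision_rare.
have M0 : 0 < m * m * d ^ 2 * 2.
  by rewrite !muln_gt0 /d; lia.
rewrite -(leq_pmul2r M0).
have -> : #|bad| * 2 * (m * m * d ^ 2 * 2) = #|bad| * m * (m * (4 * d ^ 2)).
  by ring.
rewrite -D_def.
apply: leq_trans (leq_mul h1 (leqnn _)) _.
rewrite -mulnA; apply: leq_trans (leq_mul (leqnn 2) h2) _.
by rewrite leq_eqVlt; apply/orP; left; apply/eqP; ring.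
Qed.

(** Union bound: collisions spoil at most half of the maps, and the at most 2^m balanced cuts spoil
    at most a share 2^m / 4^m <= 1/4. *)
Lemma good_function_exists : exists f,
  2 * #|colliding f| < m /\
  forall I, m <= 3 * #|I| -> m <= 3 * #|~: I| -> m <= #|crossing I f|.
Proof.
pose bal (I : {set 'I_m}) := (m <= 3 * #|I|) && (m <= 3 * #|~: I|).
pose bad1 I := [set f | #|crossing I f| < m].
pose bad2 := [set f | m <= 2 * #|colliding f|].
have F0 : 0 < #|{: {ffun S -> T}}| by rewrite card_ffun expn_gt0 cardT; lia.
have [f fP|allbad] := pickP (fun f => (f \notin bad2) &&
    [forall I, bal I ==> (f \notin bad1 I)]).
  exists f; move: fP; rewrite inE -ltnNge => /andP[-> /forallP h].
  by split=> // I I1 I2; have := h I; rewrite /bal I1 I2 inE -leqNgt.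
have cov : #|{: {ffun S -> T}}| <= #|bad2| + \sum_(I | bal I) #|bad1 I|.
  rewrite -!sum1_card; under [X in _ <= _ + X]eq_bigr do rewrite -sum1_card big_mkcond.
  rewrite [X in _ <= X + _]big_mkcond exchange_big -big_split; apply: leq_sum => f _ /=.
  move: (allbad f); case: (f \in bad2) => //= /negbT.
  rewrite negb_forall => /existsP[I]; rewrite negb_imply negbK => /andP[bI fI].
  by rewrite (bigD1 I) //= fI.
have sum1 : (\sum_(I | bal I) #|bad1 I|) * 4 ^ m <= 2 ^ m * #|{: {ffun S -> T}}|.
  rewrite big_distrl /=.
  have -> : 2 ^ m = #|{: {set 'I_m}}| 
    by rewrite -cardsT -powersetT card_powerset cardsT card_ord.
  rewrite -sum_nat_const big_mkcond; apply: leq_sum => I _.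
  by case: ifP => // /andP[I1 I2]; apply: few_crossing_rare.
have {}sum1 : (\sum_(I | bal I) #|bad1 I|) * 4 <= #|{: {ffun S -> T}}|.
  apply: leq_trans (_ : _ <= (\sum_(I | bal I) #|bad1 I|) * 2 ^ m) _.
    by rewrite leq_mul2l (@leq_exp2l 2 2) // m_gt1 orbT.
  rewrite -(@leq_pmul2l (2 ^ m)) ?expn_gt0 //; apply: leq_trans sum1.
  by rewrite (_ : 4 = 2 * 2) // expnMn mulnCA.
have := many_collisions_rare; rewrite -/bad2; lia.
Qed.

(** [None] is the symbol [off]; the two summands keep out-ports and in-ports apart, so no symbol
    serves both as a tail and as a head. *)
Definition port_edge f (x : S) : edge 'I_m (option ('I_d + 'I_D)) :=
  ((x.1, Some (inl x.2)), ((f x).1, Some (inr (f x).2))).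

(** Deleting the colliding out-ports makes [f] injective on the rest and costs fewer than m/2 of the
    at least [m] crossing edges. *)
Lemma expander_of_function f : 2 * #|colliding f| < m ->
  (forall I, m <= 3 * #|I| -> m <= 3 * #|~: I| -> m <= #|crossing I f|) ->
  expander None [set port_edge f x | x in ~: colliding f].
Proof.
move=> fcol fcross; split.
  split.
  - by move=> _ /imsetP[x _ ->].
  - move=> _ _ /imsetP[x _ ->] /imsetP[y _ ->] [e1 e2].
    by rewrite [x]surjective_pairing e1 e2 -surjective_pairing.
  - move=> _ _ /imsetP[x _ ->] /imsetP[y yc ->] [e1 e2].
    have [->//|xy] := eqVneq x y; move: yc; rewrite !inE => /existsP[].
    by exists x; rewrite xy /= [f x]surjective_pairing e1 e2 -surjective_pairing.
  - by move=> _ _ /imsetP[x _ ->] /imsetP[y _ ->].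
move=> I; rewrite card_ord => I1 I2; have := fcross _ I1 I2 => cr.
set E := [set e in _ | _].
have sub : port_edge f @: (crossing I f :\: colliding f) \subset E.
  apply/subsetP => _ /imsetP[x + ->]; rewrite !inE => /andP[xc xI].
  by rewrite xI andbT; apply: imset_f; rewrite !inE.
have inj : injective (port_edge f) by move=> [x1 x2] [y1 y2] [-> ->].
have {}cr : m <= #|colliding f| + #|E|.
  apply: leq_trans cr _; rewrite -(cardsID (colliding f) (crossing I f)).
  apply: leq_add; first exact/subset_leq_card/subsetIr.
  by rewrite -(card_imset _ inj) subset_leq_card.
by move: cr fcol; set k := #|colliding f|; set e := #|E|; lia.
Qed.

End ExpanderExistence.

(** The alphabet is chosen before [m], which makes the constants of the final bounds absolute. *)
Theorem expander_exists : exists (X : finType) (off : X), 1 < #|X| /\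
  forall m, 1 < m -> exists G : {set edge 'I_m X}, expander off G.
Proof.
have [c c_large] : exists c, 16 * 3 ^ c <= 4 ^ c.
  have h k : 4 * 3 ^ k <= 4 ^ k -> 16 * 3 ^ (k * 2) <= 4 ^ (k * 2).
    by move=> hk; rewrite -[16]/(4 ^ 2) !expnM -expnMn leq_exp2r.
  (* 4 * 3^5 = 972 <= 1024 = 4^5, and [h] squares this inequality. *)
  by exists (5 * 2); apply: h.
have c0 : 0 < c by move: c_large; case: c.
have [D D_def] : exists D, D = 4 * (3 * c) ^ 2 by eexists.
exists (option ('I_(3 * c) + 'I_D)), None; split.
  by rewrite card_option card_sum !card_ord ltnS addn_gt0 muln_gt0 c0.
move=> m m1; have [f [f1 f2]] := good_function_exists m1 c_large D_def.
by eexists; apply: expander_of_function f1 f2.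
Qed.

(** * Monotone circuits *)

Local Open Scope ring_scope.

Section MonotoneSupport.

Variables (R : numDomainType) (n : nat).

Implicit Types (p q : {mpoly R[n]}) (a b m : 'X_{1..n}).

Lemma monotone_polyD p q :
  monotone_poly p -> monotone_poly q -> monotone_poly (p + q).
Proof. by move=> hp hq m; rewrite mcoeffD addr_ge0. Qed.

Lemma monotone_polyM p q :
  monotone_poly p -> monotone_poly q -> monotone_poly (p * q).
Proof.
by move=> hp hq m; rewrite mcoeffM sumr_ge0 // => k _; rewrite mulr_ge0.
Qed.

Lemma msupp_monotoneDl p q : monotone_poly p -> monotone_poly q ->
  {subset msupp p <= msupp (p + q)}.
Proof.
move=> hp hq m; rewrite !mcoeff_msupp mcoeffD paddr_eq0 //.
by rewrite negb_and => ->.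
Qed.

Lemma msupp_monotoneDr p q : monotone_poly p -> monotone_poly q ->
  {subset msupp q <= msupp (p + q)}.
Proof. by move=> hp hq; rewrite addrC; apply: msupp_monotoneDl. Qed.

Lemma msupp_monotoneM p q a b : monotone_poly p -> monotone_poly q ->
  a \in msupp p -> b \in msupp q -> (a + b)%MM \in msupp (p * q).
Proof.
move=> hp hq; rewrite !mcoeff_msupp => pa qb; rewrite mcoeffM.
have ha : (mdeg a < (mdeg (a + b)%MM).+1)%N by rewrite ltnS mdegD leq_addr.
have hb : (mdeg b < (mdeg (a + b)%MM).+1)%N by rewrite ltnS mdegD leq_addl.
rewrite psumr_neq0 => [|k _]; last by rewrite mulr_ge0.
apply/hasP; exists (BMultinom ha, BMultinom hb); first exact: mem_index_enum.
by rewrite eqxx /= lt0r mulf_neq0 // mulr_ge0.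
Qed.

Lemma gates_polys_rcons (gs : seq (gate R n)) g :
  gates_polys (rcons gs g) =
  rcons (gates_polys gs) (gate_poly (gates_polys gs) g).
Proof. by rewrite /gates_polys -cats1 foldl_cat. Qed.

Lemma size_gates_polys (gs : seq (gate R n)) : size (gates_polys gs) = size gs.
Proof.
elim/last_ind: gs => // gs g IH.
by rewrite gates_polys_rcons !size_rcons IH.
Qed.

Lemma gates_wf_rcons k (gs : seq (gate R n)) g :
  gates_wf k (rcons gs g) = gates_wf k gs && gate_wf (k + size gs) g.
Proof.
elim: gs k => [|h gs IH] k /=; first by rewrite addn0 andbT.
by rewrite IH addSnnS andbA.
Qed.

Lemma monotone_source_poly vs (s : source R n) :
  (forall j, monotone_poly vs`_j) -> source_monotone s ->
  monotone_poly (source_poly vs s).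
Proof.
move=> hvs; case: s => [i|c|j] //= hs m.
- by rewrite mcoeffX ler0n.
- by rewrite mcoeffC mulr_ge0 // ler0n.
Qed.

Lemma monotone_gates_polys (gs : seq (gate R n)) :
  all (@gate_monotone R n) gs -> forall j, monotone_poly (gates_polys gs)`_j.
Proof.
elim/last_ind: gs => [|gs g IH] /=.
  by move=> _ j m; rewrite nth_nil mcoeff0.
rewrite all_rcons gates_polys_rcons => /andP[hg /IH {}IH] j.
rewrite nth_rcons; case: ifP => // _; case: ifP => // _; last first.
  by move=> m; rewrite mcoeff0.
by case: g hg => s t /andP[hs ht]; [apply: monotone_polyD | apply: monotone_polyM];
  apply: monotone_source_poly.
Qed.

(** Invariant of the descent through the circuit: [b] gathers the monomials of the factors left
    aside, and by monotonicity nothing multiplied by it cancels. *)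
Definition completes p q b : bool :=
  all (fun a => (a + b)%MM \in msupp p) (msupp q).

Section Descent.

Variables (w : 'X_{1..n} -> nat) (lo hi : nat).
Hypotheses (wD : forall a b, w (a + b)%MM = (w a + w b)%N)
  (w1 : forall i, (w U_(i)%MM <= 1)%N) (lo_gt0 : (0 < lo)%N)
  (lo_hi : (2 * lo <= hi)%N).

(** Descend while the weight exceeds [hi]: at a sum into a summand containing the monomial, at a
    product into a factor of weight above [lo], which exists as [2 * lo <= hi]. Inputs are never
    reached, since their weight is at most 1 and hence at most [lo]. *)
Lemma source_descent p (gs : seq (gate R n)) (s : source R n) a b :
  gates_wf 0 gs -> all (@gate_monotone R n) gs ->
  source_wf (size gs) s -> source_monotone s ->
  a \in msupp (source_poly (gates_polys gs) s) -> (lo < w a)%N ->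
  completes p (source_poly (gates_polys gs) s) b ->
  exists j a' b', [/\ (j < size gs)%N, a' \in msupp (gates_polys gs)`_j,
    (lo < w a' <= hi)%N, (a' + b' = a + b)%MM
    & completes p (gates_polys gs)`_j b'].
Proof.
have w0 : w 0%MM = 0%N by have := wD 0%MM 0%MM; rewrite addm0; lia.
elim/last_ind: gs s a b => [|gs g IH] s a b.
  move=> _ _ + _; case: s => [i|c|//] _ /=.
    by rewrite msuppX inE => /eqP->; have := w1 i; lia.
  by rewrite msuppC; case: eqP => // _; rewrite inE => /eqP->; rewrite w0; lia.
rewrite gates_wf_rcons all_rcons add0n size_rcons => /andP[wfs wfg] /andP[hg hgs].
rewrite gates_polys_rcons; set vs := gates_polys gs.
have IHs s' a' b' : source_wf (size gs) s' -> source_monotone s' ->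
    a' \in msupp (source_poly vs s') -> (lo < w a')%N ->
    completes p (source_poly vs s') b' ->
    exists j a'' b'', [/\ (j < (size gs).+1)%N,
      a'' \in msupp (rcons vs (gate_poly vs g))`_j,
      (lo < w a'' <= hi)%N, (a'' + b'' = a' + b')%MM
      & completes p (rcons vs (gate_poly vs g))`_j b''].
  move=> h1 h2 h3 h4 h5.
  have [j [a1 [b1 [jlt ha1 hw hab hc]]]] := IH s' a' b' wfs hgs h1 h2 h3 h4 h5.
  by exists j, a1, b1; rewrite nth_rcons size_gates_polys jlt; split=> //; apply: ltnW.
case: s => [i|c|j] /=.
- by move=> *; apply: (IHs (Var R i)).
- by move=> *; apply: (IHs (Const n c)).
rewrite ltnS leq_eqVlt => /orP[/eqP->|jlt] _; last first.
  by rewrite nth_rcons size_gates_polys jlt => *; apply: (IHs (Gate R n j)).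
rewrite nth_rcons size_gates_polys ltnn eqxx => ag wa cg.
have [wahi|wahi] := leqP (w a) hi.
  exists (size gs), a, b.
  by rewrite nth_rcons size_gates_polys ltnn eqxx ltnS leqnn wa wahi.
have hvs := monotone_gates_polys hgs; rewrite -/vs in hvs.
case: g wfg hg IHs ag cg => s t /andP[ws wt] /andP[hs ht] IHs ag cg.
  have ps := monotone_source_poly hvs hs; have pt := monotone_source_poly hvs ht.
  have := msuppD_le ag; rewrite mem_cat => /orP[sa|ta].
    apply: (IHs s) => //; apply/allP => a' /(msupp_monotoneDl ps pt).
    exact: (allP cg).
  apply: (IHs t) => //; apply/allP => a' /(msupp_monotoneDr ps pt).
  exact: (allP cg).
have ps := monotone_source_poly hvs hs; have pt := monotone_source_poly hvs ht.
have /allpairsP[[a1 a2] /= [sa1 ta2 ea]] := msuppM_le ag.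
have [wlt|wlt] := ltnP lo (w a1).
  (* The monomial [a2] of the factor left aside joins the context [b]. *)
  have [] := IHs s a1 (a2 + b)%MM ws hs sa1 wlt.
    apply/allP => a' sa'; rewrite addmA; apply: (allP cg).
    exact: msupp_monotoneM.
  by rewrite addmA -ea => k hk; exists k.
have {}wlt : (lo < w a2)%N by move: wahi; rewrite ea wD; lia.
have [] := IHs t a2 (a1 + b)%MM wt ht ta2 wlt.
  apply/allP => a' ta'; rewrite addmA [(a' + _)%MM]addmC; apply: (allP cg).
  exact: msupp_monotoneM.
by rewrite addmA [(a2 + _)%MM]addmC -ea => k hk; exists k.
Qed.

Lemma circuit_descent p (C : circuit R n) a :
  circuit_wf C -> circuit_monotone C -> circuit_poly C = p ->
  a \in msupp p -> (lo < w a)%N ->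
  exists j a' b', [/\ (j < circuit_size C)%N, a' \in msupp (gates_polys (gates C))`_j,
    (lo < w a' <= hi)%N, (a' + b' = a)%MM
    & completes p (gates_polys (gates C))`_j b'].
Proof.
move=> /andP[wfg wfo] /andP[hg ho] Cp ap wa.
have [] := @source_descent p (gates C) (output C) a 0%MM wfg hg wfo ho _ wa.
- by rewrite -/(circuit_poly C) Cp.
- by rewrite -/(circuit_poly C) Cp; apply/allP => a'; rewrite addm0.
by rewrite addm0 => j hj; exists j.
Qed.

End Descent.

End MonotoneSupport.

Lemma third_bounds (m i j : nat) : (m %/ 3 < i <= 2 * (m %/ 3))%N ->
  (i + j = m)%N -> (m <= 3 * i)%N /\ (m <= 3 * j)%N.
Proof. by lia. Qed.

(** * The polynomial of a graph and the rectangles of its gates *)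

Section MutualPoly.

Variables (R : realDomainType) (n m : nat) (X : finType) (off : X).
Variable G : {set edge 'I_m X}.
Variable var : 'I_m * X -> 'I_n.
Hypothesis var_inj : injective var.

Implicit Types (s : assignment 'I_m X) (a b : 'X_{1..n}).

Definition mono s : 'X_{1..n} := (\sum_v U_(var (v, s v)))%MM.

Definition mutual_coef s : R := (1 - (mutual_count G s)%:R) ^+ 2.

Definition mutual_poly : {mpoly R[n]} := \sum_s mutual_coef s *: 'X_[mono s].

Lemma mono_var s v x : mono s (var (v, x)) = (s v == x).
Proof.
rewrite /mono mnm_sumE (bigD1 v) //= big1 => [|u uv].
  by rewrite mnm1E (inj_eq var_inj) xpair_eqE eqxx addn0.
by rewrite mnm1E (inj_eq var_inj) xpair_eqE (negbTE uv).
Qed.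

Lemma mono_inj : injective mono.
Proof.
move=> s t st; apply/ffunP => v.
by have := mono_var s v (s v); rewrite st mono_var eqxx; case: eqP.
Qed.

Lemma mcoeff_mutual_poly a :
  mutual_poly@_a = \sum_(s | mono s == a) mutual_coef s.
Proof.
rewrite /mutual_poly raddf_sum [RHS]big_mkcond; apply: eq_bigr => s _ /=.
by rewrite mcoeffZ mcoeffX; case: eqP; rewrite ?mulr1 ?mulr0.
Qed.

Lemma monotone_mutual_poly : monotone_poly mutual_poly.
Proof.
by move=> a; rewrite mcoeff_mutual_poly sumr_ge0 // => s _; apply: sqr_ge0.
Qed.

(** Distinct assignments have distinct monomials, and (1 - N)^2 vanishes exactly at N = 1. *)
Lemma msupp_mutual_polyP a :
  reflect (exists2 s, a = mono s & mutual_count G s != 1)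
          (a \in msupp mutual_poly).
Proof.
have coef_neq0 s : (mutual_coef s != 0) = (mutual_count G s != 1).
  by rewrite expf_eq0 subr_eq0 eq_sym pnatr_eq1.
have pred1_mono s : (fun t => mono t == mono s) =1 pred1 s.
  by move=> t; apply: (inj_eq mono_inj).
rewrite mcoeff_msupp mcoeff_mutual_poly; apply: (iffP idP) => [h|[s ->]].
  have [s /eqP sa|no] := pickP (fun s => mono s == a); last first.
    by rewrite big_pred0 ?eqxx in h.
  exists s => //; move: h; rewrite -sa (eq_bigl _ _ (pred1_mono s)) big_pred1_eq.
  by rewrite coef_neq0.
by rewrite (eq_bigl _ _ (pred1_mono s)) big_pred1_eq coef_neq0.
Qed.

Definition block_deg a (v : 'I_m) : nat := (\sum_x a (var (v, x)))%N.

Definition block_weight a : nat := (\sum_v block_deg a v)%N.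

Lemma block_degD a b v : block_deg (a + b)%MM v = (block_deg a v + block_deg b v)%N.
Proof. by rewrite -big_split; apply: eq_bigr => x _; rewrite mnmDE. Qed.

Lemma block_deg_mono s v : block_deg (mono s) v = 1%N.
Proof.
rewrite /block_deg (bigD1 (s v)) //= mono_var eqxx big1 // => x xs.
by rewrite mono_var eq_sym (negbTE xs).
Qed.

Lemma block_weightD a b :
  block_weight (a + b)%MM = (block_weight a + block_weight b)%N.
Proof. by rewrite -big_split; apply: eq_bigr => v _; apply: block_degD. Qed.

Lemma block_weightU i : (block_weight U_(i)%MM <= 1)%N.
Proof.
rewrite /block_weight /block_deg pair_big /=.
have [p /eqP <-|no] := pickP (fun p => var p == i).
  rewrite (bigD1 p) //= big1 => [|q qp].
    by rewrite mnm1E addn0; case: eqP.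
  by rewrite mnm1E -surjective_pairing (inj_eq var_inj) eq_sym (negbTE qp).
by rewrite big1 // => -[v x] _; rewrite mnm1E eq_sym no.
Qed.

Lemma block_weight_mono s : block_weight (mono s) = m.
Proof.
rewrite /block_weight (eq_bigr _ (fun v _ => block_deg_mono s v)).
by rewrite sum_nat_const card_ord muln1.
Qed.

Lemma block_deg_eq0 a v x : block_deg a v = 0%N -> a (var (v, x)) = 0%N.
Proof. by move/eqP; rewrite sum_nat_eq0 => /forallP/(_ x)/eqP. Qed.

(** The cofactor is written as a difference to keep membership boolean; the weight window singles
    out balanced factorizations. *)
Definition gate_rectangle (F : {mpoly R[n]}) (lo hi : nat) :
    {set assignment 'I_m X} :=
  [set s | has (fun a => [&& (a <= mono s)%MM, (lo < block_weight a <= hi)%N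
     & completes mutual_poly F (mono s - a)%MM]) (msupp F)].

Lemma gate_rectangleP F lo hi s :
  reflect (exists a b, [/\ a \in msupp F, (lo < block_weight a <= hi)%N,
             (a + b)%MM = mono s & completes mutual_poly F b])
          (s \in gate_rectangle F lo hi).
Proof.
rewrite inE; apply: (iffP hasP) => [[a aF /and3P[le w c]]|[a [b [aF w ab c]]]].
  by exists a, (mono s - a)%MM; rewrite addmC submK.
exists a => //; rewrite w -ab lem_addr //= addmC addmK.
by rewrite c.
Qed.

(* All monomials computed by a gate occupy the same blocks, since they share a
   completion to a monomial with exactly one variable per block. *)
Lemma gate_rectangle_balanced F :
  let R := gate_rectangle F (m %/ 3) (2 * (m %/ 3)) in
  R = set0 \/ balanced_rectangle G R.
Proof.
move=> Rj; have [->|[s0 /gate_rectangleP]] := set_0Vmem Rj; first by left.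
case=> a0 [b0 [aF0 w0 ab0 c0]]; right.
have da a : a \in msupp F -> block_deg a =1 block_deg a0.
  move=> aF v; have /msupp_mutual_polyP[s es _] := allP c0 _ aF.
  have := block_degD a b0 v; have := block_degD a0 b0 v.
  by rewrite es ab0 !block_deg_mono; lia.
have db b : completes mutual_poly F b -> block_deg b =1 block_deg b0.
  move=> cb v; have /msupp_mutual_polyP[s es _] := allP cb _ aF0.
  have := block_degD a0 b v; have := block_degD a0 b0 v.
  by rewrite es ab0 !block_deg_mono; lia.
have d01 v : (block_deg a0 v + block_deg b0 v = 1)%N.
  by rewrite -block_degD ab0 block_deg_mono.
(* Every block has total degree 1, so it lies wholly in the gate factor, which defines [I], or
   wholly in the cofactor. *)
pose I := [set v | block_deg a0 v == 1%N].
have cI : #|I| = block_weight a0.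
  rewrite -sum1_card big_mkcond; apply: eq_bigr => v _; rewrite inE.
  by case: eqP => //; have := d01 v; lia.
have cIC : (#|I| + #|~: I| = m)%N by rewrite cardsC card_ord.
have cI2 : (block_weight a0 + #|~: I| = m)%N by rewrite -cI.
exists I; rewrite card_ord cI; split.
- by have [] := third_bounds w0 cI2.
- by have [] := third_bounds w0 cI2.
move=> s1 s2 /gate_rectangleP[a1 [b1 [aF1 _ ab1 c1]]].
move=> /gate_rectangleP[a2 [b2 [aF2 _ ab2 c2]]].
(* The rectangle property: the gate factor of [s1] times the cofactor of [s2] is again a monomial of
   the polynomial, and its assignment is the splice. *)
have /msupp_mutual_polyP[t et tcount] := allP c2 _ aF1.
suff -> : splice I s1 s2 = t by [].
apply/ffunP => v; rewrite ffunE; apply/eqP.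
have := mono_var t v; rewrite -et => ht.
case: ifPn; rewrite inE => vI.
  have b0v : block_deg b0 v = 0%N by have := d01 v; lia.
  have := mono_var s1 v (s1 v); rewrite -ab1 mnmDE eqxx.
  rewrite [b1 _]block_deg_eq0 ?(db _ c1) // addn0 => a1v.
  by have := ht (s1 v); rewrite mnmDE a1v [t v == _]eq_sym; case: eqP.
have a0v : block_deg a0 v = 0%N by have := d01 v; lia.
have := mono_var s2 v (s2 v); rewrite -ab2 mnmDE eqxx.
rewrite [a2 _]block_deg_eq0 ?(da _ aF2) // add0n => b2v.
by have := ht (s2 v); rewrite mnmDE b2v addnC [t v == _]eq_sym; case: eqP.
Qed.

(** Each gate contributes one rectangle. They cover the mutual-free assignments, whose monomials
    have coefficient 1 and weight [m], so the descent finds a gate for each. *)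
Lemma monotone_circuit_bound (C : circuit R n) (k : nat) :
  (2 < m)%N -> (1 < #|X|)%N -> expander off G ->
  (k * (4 * #|X|) <= m)%N ->
  circuit_wf C -> circuit_monotone C -> circuit_poly C = mutual_poly ->
  (2 ^ k <= circuit_size C ^ (#|X| ^ 2))%N.
Proof.
move=> m2 X1 Gexp km wfC monC Cp.
pose F (j : 'I_(circuit_size C)) := (gates_polys (gates C))`_j.
pose Rj j := gate_rectangle (F j) (m %/ 3) (2 * (m %/ 3)).
apply: expn_ratio_bound; first by rewrite -(exp1n 2) ltn_exp2r.
rewrite -{1}(card_ord (circuit_size C)).
apply: (cover_bound (off := off) (R := Rj) (G := G)) => //.
- by rewrite card_ord.
- by move=> j; apply: gate_rectangle_balanced.
move=> s; rewrite inE => /eqP s0.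
have sP : mono s \in msupp mutual_poly.
  by apply/msupp_mutual_polyP; exists s; rewrite // s0.
have lo0 : (0 < m %/ 3)%N by rewrite divn_gt0.
have lom : (m %/ 3 < block_weight (mono s))%N.
  by rewrite block_weight_mono ltn_Pdiv // ltnW // ltnW.
have [j [a [b [jC aF wa ab cb]]]] :=
  circuit_descent block_weightD block_weightU lo0 (leqnn _) wfC monC Cp sP lom.
by exists (Ordinal jC); apply/gate_rectangleP; exists a, b.
Qed.

End MutualPoly.

(** * Depth-three circuits *)

Section DepthThree.

Variables (R : realDomainType) (n m : nat) (X : finType).
Variable G : {set edge 'I_m X}.
Variable var : 'I_m * X -> 'I_n.

(* [None] stands for the constant 1 in [1 - mutual_count G s], [Some e] for the
   indicator of [mutual s e]; a pair of terms is a term of the square. *)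
Definition term : finType := option {e : edge 'I_m X | e \in G}.

(** Splits the indicator of a term into one condition per vertex, which makes it a product function
    of the assignment. *)
Definition admits (t : term) (v : 'I_m) (x : X) : bool :=
  if t is Some e then
    ((v == (val e).1.1) ==> (x == (val e).1.2)) &&
    ((v == (val e).2.1) ==> (x == (val e).2.2))
  else true.

Definition term_sign (t : term) : R := if t is Some _ then -1 else 1.

Lemma admits_mutual (e : {e : edge 'I_m X | e \in G}) (s : assignment 'I_m X) :
  [forall v, admits (Some e) v (s v)] = mutual s (val e).
Proof.
apply/forallP/andP => [h|[/eqP h1 /eqP h2] v].
  have /andP[/implyP h1 _] := h (val e).1.1.
  have /andP[_ /implyP h2] := h (val e).2.1.
  by split; [apply: h1 | apply: h2].
by apply/andP; split; apply/implyP => /eqP ->; rewrite ?h1 ?h2.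
Qed.

Lemma sum_term_sign (s : assignment 'I_m X) :
  \sum_(t : term) term_sign t * [forall v, admits t v (s v)]%:R
    = 1 - (mutual_count G s)%:R.
Proof.
rewrite (bigD1 None) //=.
have -> : [forall v : 'I_m, true] by apply/forallP.
rewrite mul1r; congr (_ + _).
rewrite (reindex_omap (@Some {e | e \in G}) id) /=; last by case.
rewrite (eq_bigl xpredT) => [|e]; last exact: eqxx.
under eq_bigr do rewrite (admits_mutual _ s) mulN1r.
rewrite sumrN /mutual_count -(big_sub G (fun e => (mutual s e)%:R)).
rewrite -sum1_card natr_sum [in RHS]big_mkcond [in LHS]big_mkcond /=.
congr (- _); apply: eq_bigr => e _; rewrite inE.
by case: (e \in G) => //=; case: (mutual s e).
Qed.

Lemma prod_natr_bool (I : finType) (b : pred I) :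
  \prod_i ((b i)%:R : R) = [forall i, b i]%:R.
Proof.
have [/forallP h|/forallPn[i bi]] := boolP [forall i, b i].
  by rewrite big1 // => i _; rewrite h.
by rewrite (bigD1 i) //= (negbTE bi) mul0r.
Qed.

Lemma forall_andb (I : finType) (b c : pred I) :
  [forall i, b i && c i] = [forall i, b i] && [forall i, c i].
Proof.
apply/forallP/andP => [h|[/forallP hb /forallP hc] i]; last by rewrite hb hc.
by split; apply/forallP => i; have /andP[] := h i.
Qed.

(** Product gates carry no scalars, so the sign of a pair of terms enters as an additional constant
    form, indexed by [None]. *)
Definition term_form (p : term * term) (o : option 'I_m) : affine_form R n :=
  if o is Some v then
    AffineForm [ffun i => \sum_x
      ([&& admits p.1 v x, admits p.2 v x & var (v, x) == i] : nat)%:R] 0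
  else AffineForm [ffun=> 0] (term_sign p.1 * term_sign p.2).

Lemma term_form_Some p v : affine_poly (term_form p (Some v)) =
  \sum_x ((admits p.1 v x && admits p.2 v x)%:R : R) *: 'X_(var (v, x)).
Proof.
rewrite /affine_poly /= mpolyC0 addr0.
under eq_bigr do rewrite ffunE scaler_suml.
rewrite exchange_big; apply: eq_bigr => x _ /=.
rewrite (bigD1 (var (v, x))) //= big1 => [|i ix].
  by rewrite eqxx andbT addr0.
by rewrite [_ == i]eq_sym (negbTE ix) !andbF scale0r.
Qed.

Lemma term_form_None p : affine_poly (term_form p None) =
  (term_sign p.1 * term_sign p.2)%:MP.
Proof.
by rewrite /affine_poly big1 ?add0r // => i _; rewrite ffunE scale0r.
Qed.

Definition mutual_circuit : sps_circuit R n :=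
  @SPSCircuit R n #|{: (term * term) * option 'I_m}|
    (fun j => term_form (enum_val j).1 (enum_val j).2)
    [seq [seq enum_rank (p, o) | o <- None :: [seq Some v | v <- enum 'I_m]]
       | p <- enum {: term * term}].

(** Distributivity: choosing one variable from the form of each vertex is choosing an assignment. *)
Lemma term_product p :
  \prod_(o <- None :: [seq Some v | v <- enum 'I_m]) affine_poly (term_form p o)
  = \sum_(s : assignment 'I_m X)
      ((term_sign p.1 * [forall v, admits p.1 v (s v)]%:R) *
       (term_sign p.2 * [forall v, admits p.2 v (s v)]%:R)) *: 'X_[mono var s].
Proof.
rewrite big_cons big_map big_enum term_form_None mul_mpolyC.
under eq_bigr do rewrite term_form_Some.
rewrite bigA_distr_bigA scaler_sumr; apply: eq_bigr => s _ /=.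
rewrite scaler_prod scalerA prod_natr_bool forall_andb -mulnb natrM mulrACA.
by rewrite /mono (big_morph (fun a => 'X_[a]) (@mpolyXD _ _) (mpolyX0 _ _)).
Qed.

Lemma sps_poly_mutual_circuit : sps_poly mutual_circuit = mutual_poly R G var.
Proof.
rewrite /sps_poly big_map big_enum.
under eq_bigr => p _.
  rewrite big_map (eq_bigr (fun o => affine_poly (term_form p o))); last first.
    by move=> o _; rewrite /= enum_rankK.
  rewrite term_product; over.
rewrite exchange_big; apply: eq_bigr => s _ /=.
rewrite -scaler_suml; congr (_ *: _).
rewrite -(pair_bigA _ (fun p q => (term_sign p * [forall v, admits p v (s v)]%:R) *
  (term_sign q * [forall v, admits q v (s v)]%:R))) /=.
rewrite /mutual_coef -sum_term_sign expr2 big_distrl; apply: eq_bigr => p _.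
by rewrite big_distrr.
Qed.

Lemma affine_wires_term_form p o : (affine_wires (term_form p o) <= #|X|.+1)%N.
Proof.
case: o => [v|]; rewrite /affine_wires /=.
  rewrite eqxx addn0; apply: leqW.
  have sub : [set i | af_coef (term_form p (Some v)) i != 0] \subset
      [set var (v, x) | x in X].
    apply/subsetP => i; rewrite inE ffunE; apply: contraNT => iX.
    apply/eqP/big1 => x _; case: eqP => [ei|]; last by rewrite !andbF.
    by case/negP: iX; apply/imsetP; exists x.
  exact: leq_trans (subset_leq_card sub) (leq_imset_card _ _).
rewrite (_ : [set i | _] = set0) ?cards0 ?add0n.
  by case: eqP => // _; rewrite ltnS leq0n.
by apply/setP => i; rewrite !inE ffunE eqxx.
Qed.

Lemma card_term : #|term| = #|G|.+1.
Proof. by rewrite card_option card_sig; congr S; apply: eq_card. Qed.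

(** There are [t * t] products of [m.+1] forms, each form with at most |X| + 1 wires; the bounds t
    <= 2 n, used twice, and m + 1 <= 2 n yield the factor 8. *)
Lemma sps_size_mutual_circuit : (0 < #|X|)%N -> (m * #|X| <= n)%N ->
  (#|G| <= n)%N -> (0 < n)%N ->
  (sps_size mutual_circuit <= 8 * (#|X| + 6) * n ^ 3)%N.
Proof.
move=> X0 mXn Gn n0.
have mn : (m <= n)%N by apply: leq_trans mXn; rewrite leq_pmulr.
set t := #|term|; have t2n : (t <= 2 * n)%N by rewrite /t card_term; lia.
have cJ : #|{: (term * term) * option 'I_m}| = (t * t * m.+1)%N.
  by rewrite !card_prod; congr (_ * _)%N; rewrite card_option card_ord.
have sP : size (sps_products mutual_circuit) = (t * t)%N.
  by rewrite size_map -cardE card_prod.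
have wires : (\sum_(j < sps_width mutual_circuit)
    affine_wires (sps_form mutual_circuit j) <= t * t * m.+1 * #|X|.+1)%N.
  rewrite -cJ.
  apply: leq_trans (_ : _ <= \sum_(j < sps_width mutual_circuit) #|X|.+1)%N _.
    by apply: leq_sum => j _; apply: affine_wires_term_form.
  by rewrite sum_nat_const card_ord.
have sizes : (\sum_(s <- sps_products mutual_circuit) size s = t * t * m.+1)%N.
  rewrite big_map big_enum (eq_bigr (fun=> m.+1)) => [|p _].
    by rewrite sum_nat_const card_prod.
  by rewrite size_map /= size_map size_enum_ord.
have {}wires : (sps_wires mutual_circuit <=
    t * t * m.+1 * #|X|.+1 + t * t * m.+1 + t * t)%N.
  by rewrite /sps_wires sizes sP !leq_add2r.
have gates : sps_gates mutual_circuit = (t * t * m.+1 + t * t + 1)%N.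
  by rewrite /sps_gates sP; congr (_ + _ + _)%N; apply: cJ.
apply: leq_trans (_ : _ <= t * t * m.+1 * (#|X| + 6))%N _.
  rewrite /sps_size gates; apply: leq_trans (leq_add (leqnn _) wires) _.
  have : (0 < t)%N by rewrite /t card_term.
  by clear; nia.
have m2n : (m.+1 <= 2 * n)%N by lia.
apply: leq_trans (leq_mul (leq_mul (leq_mul t2n t2n) m2n) (leqnn _)) _.
by rewrite leq_eqVlt; apply/orP; left; apply/eqP; ring.
Qed.

End DepthThree.

(** * Real exponents and assembly of the family *)

Lemma powR2_le_of_expn (R : realType) (x : R) (k s L : nat) :
  (0 < L)%N -> (2 ^ k <= s ^ L)%N -> x * L%:R <= k%:R -> 2 `^ x <= s%:R.
Proof.
move=> L0 ks xL; rewrite -(ler_pXn2r L0) ?nnegrE ?powR_ge0 ?ler0n //.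
rewrite -powR_mulrn ?powR_ge0 // -powRrM.
apply: le_trans (_ : 2 `^ k%:R <= _); first by apply: ler_powR => //; rewrite ler1n.
by rewrite powR_mulrn // -!natrX ler_nat.
Qed.

(** All constants depend on |X| alone, so they are uniform when a polynomial is chosen for each
    [n]. *)
Definition hard_polynomial (R : realType) (X : finType) (n : nat)
    (P : {mpoly R[n]}) : Prop :=
  [/\ monotone_poly P,
      exists S : sps_circuit R n,
        sps_poly S = P /\ (sps_size S <= 8 * (#|X| + 6) * n ^ 3)%N
    & (4 * #|X| ^ 2 <= n)%N -> forall C : circuit R n,
        circuit_wf C -> circuit_monotone C -> circuit_poly C = P ->
        2 `^ ((8 * #|X| ^ 4)%:R^-1 * n%:R : R) <= (circuit_size C)%:R].

Section Family.

Variables (R : realType) (X : finType) (off : X).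
Hypothesis X1 : (1 < #|X|)%N.
Hypothesis Xexp : forall m, (1 < m)%N ->
  exists G : {set edge 'I_m X}, expander off G.

Let X0 : (0 < #|X|)%N. Proof. exact: ltnW. Qed.

Lemma hard_polynomial_exists (n : nat) : (0 < n)%N ->
  exists P : {mpoly R[n]}, hard_polynomial X P.
Proof.
move=> n0; pose m := (n %/ #|X|)%N.
have mX : (m * #|X| <= n)%N by apply: leq_divM.
have [G [Gn Gexp]] : exists G : {set edge 'I_m X},
    (#|G| <= n)%N /\ ((1 < m)%N -> expander off G).
  (* With fewer than two vertices the empty graph serves, as the lower bound is claimed only for [n]
     large enough to force [m > 2]. *)
  have [m1|m1] := ltnP 1 m; last by exists set0; rewrite cards0.
  have [G Gexp] := Xexp m1; exists G; split=> //.
  apply: leq_trans mX; have [[_ i1 _ _] _] := Gexp.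
  rewrite -(card_in_imset i1); apply: leq_trans (max_card _) _.
  by rewrite card_prod card_ord.
have cVX : (#|{: 'I_m * X}| <= n)%N by rewrite card_prod card_ord.
pose var (p : 'I_m * X) := widen_ord cVX (enum_rank p).
have var_inj : injective var.
  by move=> p q /(congr1 val) /= /val_inj /enum_rank_inj.
exists (mutual_poly R G var); split.
- exact: monotone_mutual_poly.
- exists (mutual_circuit R G var); split; first exact: sps_poly_mutual_circuit.
  exact: sps_size_mutual_circuit.
move=> nX C wfC monC Cp.
have m2 : (2 < m)%N.
  rewrite leq_divRL //; apply: leq_trans nX.
  by rewrite expnS expn1 mulnA leq_mul2r; lia.
set k := (n %/ (4 * #|X| ^ 2))%N.
have km : (k * (4 * #|X|) <= m)%N.
  rewrite leq_divRL //; apply: leq_trans (leq_divM n (4 * #|X| ^ 2)).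
  by rewrite -/k leq_eqVlt; apply/orP; left; apply/eqP; ring.
have bound := monotone_circuit_bound var_inj m2 X1 (Gexp (ltnW m2)) km wfC monC Cp.
apply: powR2_le_of_expn bound _; first by rewrite expn_gt0 X0.
have L0 : (0 < 8 * #|X| ^ 4)%N by rewrite muln_gt0 expn_gt0 X0.
rewrite -mulrA mulrC ler_pdivrMr ?ltr0n // -!natrM ler_nat.
have B0 : (0 < 4 * #|X| ^ 2)%N by rewrite muln_gt0 expn_gt0 X0.
(* As n >= 4 |X|^2, rounding down at most halves the quotient, so k >= n / (8 |X|^2). The exponent k
   / |X|^2 is then at least n / (8 |X|^4). *)
have nk : (n <= 2 * (4 * #|X| ^ 2) * k)%N.
  have k0 : (0 < k)%N by rewrite divn_gt0.
  have := ltn_ceil n B0; rewrite -/k => lt.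
  apply: leq_trans (ltnW lt) _.
  by rewrite mulSn -mulnA mulnC [X in (_ <= X)%N]mulnC mulnC; nia.
apply: leq_trans (leq_mul nk (leqnn _)) _.
by rewrite leq_eqVlt; apply/orP; left; apply/eqP; ring.
Qed.

End Family.

Theorem theorem1p1 (R : realType) :
  exists P : forall n : nat, {mpoly R[n]},
    [/\ forall n : nat, (1 <= n)%N -> monotone_poly (P n),
        exists K : nat, forall n : nat, (1 <= n)%N ->
          exists S : sps_circuit R n,
            sps_poly S = P n /\ (sps_size S <= K * n ^ 3)%N
      & exists (c : R) (n0 : nat), 0 < c /\
          forall n : nat, (1 <= n)%N -> (n0 <= n)%N ->
          forall C : circuit R n,
            circuit_wf C -> circuit_monotone C -> circuit_poly C = P n ->
            2 `^ (c * n%:R) <= (circuit_size C)%:R].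
Proof.
have [X [off [X1 Xexp]]] := expander_exists.
have Pex n : exists P : {mpoly R[n]}, (0 < n)%N -> hard_polynomial X P.
  (* The value 0 at [n = 0] is a default that makes the chosen family total. *)
  have [->|n0] := posnP n; first by exists 0.
  by have [P hP] := hard_polynomial_exists R X1 Xexp n0; exists P.
pose P n := sval (boolp.cid (Pex n)).
have hP n : (0 < n)%N -> hard_polynomial X (P n) by exact: (svalP (boolp.cid (Pex n))).
exists P; split.
- by move=> n /hP[].
- by exists (8 * (#|X| + 6))%N => n /hP[].
exists (8 * #|X| ^ 4)%:R^-1, (4 * #|X| ^ 2)%N; split.
  by rewrite invr_gt0 ltr0n muln_gt0 expn_gt0 (ltnW X1).
by move=> n /hP[].
Qed.
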